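(* Let $S\ne\{0\}$ be a strongly $E^*$-unitary inverse semigroup and $R$ a commutative unital ring. Let $S^\ast=S\cup\{\ast\}$ be the inverse semigroup obtained by adjoining a new identity element $\ast$. Then $S^\ast$ is strongly $E^*$-unitary (a pure grading $\varphi:S^\times\to G$ extends by $\varphi(\ast)=1_G$), the inclusion of idempotent semilattices $E\subseteq E^\ast$ preserves finite covers, and: (1) $L_R(S^\ast)$ is a unital $R$-algebra; (2) there is a natural injective $R$-algebra homomorphism $L_R(S)\hookrightarrow L_R(S^\ast)$, given by $x\delta_g\mapsto x\delta_g$; (3) this inclusion is surjective (so $L_R(S)=L_R(S^\ast)$) if and only if $L_R(S)$ is unital; (4) the image of $L_R(S)$ is an essential ideal of $L_R(S^\ast)$, i.e. it is a two-sided ideal $I$ such that for $x\in L_R(S^\ast)$, $xI=Ix=0$ implies $x=0$.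
   Context: An inverse semigroup with zero $S$ has unique inverses $s^*$; $E$ denotes its idempotents (a meet semilattice with $x\wedge y=xy$, least element $0$), $S^\times=S\setminus\{0\}$, $E^\times=E\setminus\{0\}$. A pure grading is a map $\varphi:S^\times\to G$ to a group with $\varphi(ab)=\varphi(a)\varphi(b)$ whenever $ab\ne0$ and $\varphi^{-1}(1_G)=E^\times$; $S$ is strongly $E^*$-unitary if one exists. For $g\in G$, $E_g=\{x\in E: x\le ss^*$ for some $s$ with $\varphi(s)=g\}$ if $\varphi^{-1}(g)\ne\emptyset$, else $\{0\}$; $\phi_g:E_{g^{-1}}\to E_g$, $x\mapsto sxs^*$ ($\varphi(s)=g$, $x\le s^*s$). For a meet semilattice $P$ with $0$: a filter is a subset $F$, $\emptyset\ne F\ne P$, closed upwards and under meets; $F(P)$ has topology generated by $\{F:x\in F\}$; tight filters $T(P)$ are the closure of the ultrafilters; $V^P_{(x:x_1,\dots,x_n)}=\{\xi\in T(P):x\in\xi, x_i\notin\xi\}$, $V_x=V_{(x:)}$; $\mathcal T_c(P)$ is the generalized Boolean algebra of compact open subsets of $T(P)$. A finite cover of $x\in P$ is a finite set of elements $\le x$ such that every $0\ne y\le x$ meets one of them nontrivially; $P_1\subseteq P_2$ preserves finite covers if every finite cover in $P_1$ of $x\in P_1$ is a finite cover of $x$ in $P_2$. $\mathcal T_c(E_g)$ is identified with the ideal of $\mathcal T_c(E)$ of compact open sets contained in $\bigcup_{x\in E_g}V^E_x$, and $\hat\phi_g:\mathcal T_c(E_{g^{-1}})\to\mathcal T_c(E_g)$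 is the isomorphism induced by $\phi_g$; $\Phi=(\{\mathcal T_c(E_g)\},\{\hat\phi_g\})$ is a partial action of $G$ on $\mathcal T_c(E)$. For a partial action $\Phi=(\{\mathcal I_t\},\{\psi_t\})$ on a generalized Boolean algebra $\mathcal B$: $\mathrm{Lc}(R,\mathcal B)$ is the $R$-algebra of functions $f:R\setminus\{0\}\to\mathcal B$ with pairwise disjoint values, almost all $0$, viewed as $\sum_r r1_{f(r)}$; $\mathrm{Lc}(R,\mathcal B)\rtimes_\Phi G$ consists of finite sums $\sum_t f_t\delta_t$, $f_t\in\mathrm{Lc}(R,\mathcal I_t)$, with $(a\delta_s)(b\delta_t)=\tilde\psi_s(\tilde\psi_{s^{-1}}(a)b)\delta_{st}$, $\tilde\psi_t(f)=\psi_t\circ f$. $L_R(S,\varphi):=\mathrm{Lc}(R,\mathcal T_c(E))\rtimes_\Phi G$; it is independent of the pure grading up to isomorphism and written $L_R(S)$. For $x\in E_g$, $x\delta_g:=1_{V_x}\delta_g$. *)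

(* Defs.v *)
From HB Require Import structures.
From mathcomp Require Import all_boot all_algebra.
From mathcomp Require Import boolp classical_sets cardinality fsbigop.

Set Implicit Arguments.
Unset Strict Implicit.
Unset Printing Implicit Defensive.

Import GRing.Theory.
Local Open Scope classical_set_scope.
Local Open Scope ring_scope.

Section InverseSemigroup.
Variables (T : Type) (mul : T -> T -> T) (st : T -> T) (z : T).

Definition is_inv_semigroup0 : Prop :=
  [/\ (forall a b c, mul a (mul b c) = mul (mul a b) c),
      (forall a, mul z a = z /\ mul a z = z),
      (forall a, mul (mul a (st a)) a = a /\ mul (mul (st a) a) (st a) = st a) &
      (forall a b, mul (mul a b) a = a -> mul (mul b a) b = b -> b = st a)].

(* the idempotents E; a meet semilattice with x /\ y = x y and least elt z *)
Definition idem : set T := [set e | mul e e = e].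
Definition leE (x y : T) : Prop := x = mul x y.

Definition is_filter (F : set T) : Prop :=
  [/\ F `<=` idem, (exists x, F x), F <> idem,
      (forall x y, F x -> idem y -> leE x y -> F y) &
      (forall x y, F x -> F y -> F (mul x y))].

Definition is_ultrafilter (F : set T) : Prop :=
  is_filter F /\ (forall F', is_filter F' -> F `<=` F' -> F' = F).

(* tight filters: the closure of the ultrafilters in the space of filters,
   whose topology is generated by the sets {F | x \in F} and {F | y \notin F}
   (x, y \in E); a filter is in the closure iff every basic neighbourhood
   {F | X \subset F, Y \cap F = \emptyset} (X, Y finite) meets an ultrafilter *)
Definition is_tight (xi : set T) : Prop :=
  is_filter xi /\
  (forall X Y : set T, finite_set X -> finite_set Y -> Y `<=` idem ->
     X `<=` xi -> (forall y, Y y -> ~ xi y) ->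
     exists u, [/\ is_ultrafilter u, X `<=` u & (forall y, Y y -> ~ u y)]).

Definition Tight : set (set T) := [set xi | is_tight xi].

Definition basicT (X Y : set T) : set (set T) :=
  [set xi | [/\ is_tight xi, X `<=` xi & (forall y, Y y -> ~ xi y)]].

Definition openT (A : set (set T)) : Prop :=
  A `<=` Tight /\
  (forall xi, A xi -> exists X Y : set T,
      [/\ finite_set X, finite_set Y, Y `<=` idem, basicT X Y xi &
          basicT X Y `<=` A]).

Definition compactT (A : set (set T)) : Prop :=
  forall (I : Type) (U : I -> set (set T)), (forall i, openT (U i)) ->
    A `<=` \bigcup_(i in [set: I]) U i ->
    exists J : set I, finite_set J /\ A `<=` \bigcup_(i in J) U i.

Definition compact_openT (A : set (set T)) : Prop := openT A /\ compactT A.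

Definition V (x : T) : set (set T) := [set xi | is_tight xi /\ xi x].

Definition is_fincover (x : T) (Z : set T) : Prop :=
  [/\ finite_set Z, Z `<=` idem, (forall w, Z w -> leE w x) &
      (forall y, idem y -> y <> z -> leE y x -> exists w, Z w /\ mul y w <> z)].

End InverseSemigroup.

Section Grading.
Variables (T : Type) (mul : T -> T -> T) (st : T -> T) (z : T).
Variables (G : groupType) (phi : T -> G).

(* phi restricted to S^x = T \ {z} is a pure grading *)
Definition pure_grading : Prop :=
  (forall a b, mul a b <> z -> phi (mul a b) = monoid.mul (phi a) (phi b)) /\
  (forall a, a <> z -> (phi a = (monoid.one : G) <-> idem mul a)).

Definition Egr (g : G) : set T :=
  [set x | x = z \/
     (idem mul x /\ exists s, [/\ s <> z, phi s = g & leE mul x (mul s (st s))])].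

(* the open subset \bigcup_{x \in E_g} V_x of T(E), identified with T(E_g) *)
Definition Dgr (g : G) : set (set T) :=
  [set xi | is_tight mul xi /\ exists x, Egr g x /\ xi x].

(* the homeomorphism D_{g^-1} -> D_g induced by phi_g : x |-> s x s^*  *)
(* (tight filter xi |-> upward closure of phi_g (xi \cap E_{g^-1}))       *)
Definition theta (g : G) (xi : set T) : set T :=
  [set y | idem mul y /\
     exists x s, [/\ xi x, s <> z, phi s = g, leE mul x (mul (st s) s) &
                     leE mul (mul (mul s x) (st s)) y]].

Variable R : comPzRingType.

(* Lc(R, T_c(E_g)): an element sum_r r 1_{f(r)} is represented by the function
   on (tight) filters taking value r on f(r) and 0 elsewhere *)
Definition Lc (g : G) (f : set T -> R) : Prop :=
  [/\ (forall xi, ~ Dgr g xi -> f xi = 0),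
      finite_set [set r | r <> 0 /\ exists xi, f xi = r] &
      (forall r, r <> 0 -> compact_openT mul [set xi | f xi = r])].

(* elements of L_R(S, phi) = Lc(R, T_c(E)) x| G : finite sums sum_t a_t delta_t *)
Definition inL (a : G -> set T -> R) : Prop :=
  finite_set [set g | a g <> (fun _ => 0)] /\ (forall g, Lc g (a g)).

(* \tilde psi_t (f) = psi_t o f, as a function on T(E) *)
Definition transport (t : G) (f : set T -> R) : set T -> R :=
  fun eta => if asbool (Dgr t eta) then f (theta (monoid.inv t) eta) else 0.

(* (a delta_s)(b delta_t) = \tilde psi_s(\tilde psi_{s^-1}(a) b) delta_{st} *)
Definition mulL (a b : G -> set T -> R) : G -> set T -> R :=
  fun g eta =>
    \sum_(s \in [set s | a s <> (fun _ => 0)])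
      transport s (fun xi => transport (monoid.inv s) (a s) xi *
                             b (monoid.mul (monoid.inv s) g) xi) eta.

Definition deltaV (x : T) (g : G) : G -> set T -> R :=
  fun h xi => if h == g then (asbool (V mul x xi))%:R else 0.

Definition unitalL : Prop :=
  exists e, inL e /\ (forall a, inL a -> mulL e a = a /\ mulL a e = a).

End Grading.

Definition addL (T : Type) (G : Type) (R : comPzRingType)
  (a b : G -> set T -> R) : G -> set T -> R := fun g xi => a g xi + b g xi.
Definition scaleL (T : Type) (G : Type) (R : comPzRingType)
  (r : R) (a : G -> set T -> R) : G -> set T -> R := fun g xi => r * a g xi.
Definition zeroL (T : Type) (G : Type) (R : comPzRingType) : G -> set T -> R :=
  fun _ _ => 0.

(* S^* = S u {*}, with * = None a new identity element                       *)
Definition optmul (T : Type) (mul : T -> T -> T) (a b : option T) : option T :=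
  match a, b with
  | None, _ => b
  | _, None => a
  | Some x, Some y => Some (mul x y)
  end.
Definition optstar (T : Type) (st : T -> T) (a : option T) : option T :=
  match a with None => None | Some x => Some (st x) end.
Definition optphi (T : Type) (G : groupType) (phi : T -> G) (a : option T) : G :=
  match a with None => (monoid.one : G) | Some x => phi x end.

(* Main.v *)
(* A filter of the idempotents of S+{*} always contains [*], so it is [star F] for a
   filter [F] of E, or the filter [star set0] = {*}; since E is nonzero the latter is not
   an ultrafilter.  Hence the tight spectrum of S+{*} is that of S, possibly with one
   point at infinity added, and the algebra of S consists of the elements of the algebra
   of S+{*} that vanish there.  This is an ideal because infinity is fixed by the partial
   action, and it is essential because infinity, when tight, is a limit of ultrafilters
   of E.  The unit is the indicator function of the compact set of tight filters
   containing [*], which is the whole spectrum. *)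
Require Import Defs.
From HB Require Import structures.
From mathcomp Require Import all_boot all_algebra.
From mathcomp Require Import boolp classical_sets cardinality fsbigop filter.
Local Open Scope classical_set_scope.

Set Implicit Arguments.
Unset Strict Implicit.
Unset Printing Implicit Defensive.

Import GRing.Theory.

(** All products are computed pointwise. Once the two transports in [mulL] cancel, the value of
    [mulL a b g] at [eta] is the sum over [s] of [a s eta] times [b] in degree [s^-1 g] at the point
    [theta (inv s) eta], as in the convolution algebra of a transformation groupoid. The obstacle is
    [theta], which quantifies over all semigroup elements of degree [g]; purity of the grading lets
    a single element compute it on a whole neighbourhood. The other recurring task is membership in
    [Lc], for products as well as for functions moved between the two spectra. It is always reduced
    to local constancy and compact support, which is what the compactness of [V x] and the
    closedness of compact sets serve. *)

Lemma filter_bigcap (I U : Type) (D : set I) (f : I -> set U) (F : set_system U) :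
  Filter F -> finite_set D -> (forall i, D i -> F (f i)) ->
  F (\bigcap_(i in D) f i).
Proof.
(* [Pchoice] gives the arbitrary index type a choice structure, so that [fset_set] applies. *)
elim/Pchoice: I => I in D f * => FF fD Ff.
rewrite -(fset_setK fD); apply: filter_bigI => i; rewrite in_fset_set // inE.
exact: Ff.
Qed.

(** * Calculus in an inverse semigroup with zero *)

Section InverseSemigroupTheory.
Variables (T : Type) (mul : T -> T -> T) (st : T -> T) (z : T).
Hypothesis HS : is_inv_semigroup0 mul st z.

Local Notation "a ** b" := (mul a b) (at level 40, left associativity).
Local Notation idem := (idem mul).

Lemma smulA a b c : a ** (b ** c) = a ** b ** c.
Proof. by case: HS => ->. Qed.

Lemma smul0s a : z ** a = z.
Proof. by case: HS => _ /(_ a)[]. Qed.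

Lemma smuls0 a : a ** z = z.
Proof. by case: HS => _ /(_ a)[]. Qed.

Lemma smul_st_s a : a ** st a ** a = a.
Proof. by case: HS => _ _ /(_ a)[]. Qed.

Lemma st_smul_st a : st a ** a ** st a = st a.
Proof. by case: HS => _ _ /(_ a)[]. Qed.

Lemma st_uniq a b : a ** b ** a = a -> b ** a ** b = b -> b = st a.
Proof. by case: HS => _ _ _; apply. Qed.

Lemma stK a : st (st a) = a.
Proof. by symmetry; apply: st_uniq; [exact: st_smul_st|exact: smul_st_s]. Qed.

Lemma st_idem e : idem e -> st e = e.
Proof. by move=> ee; symmetry; apply: st_uniq; rewrite !ee. Qed.

Lemma idem_z : idem z. Proof. exact: smul0s. Qed.

Lemma idem_s_st a : idem (a ** st a).
Proof. by rewrite /Defs.idem/= smulA smul_st_s. Qed.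

Lemma idem_st_s a : idem (st a ** a).
Proof. by rewrite /Defs.idem/= smulA st_smul_st. Qed.

(** Here and below, names in [K] mark cancellations with a trailing factor [x], so that they fire
    inside right-associated products. *)
Lemma idemK e x : idem e -> e ** (e ** x) = e ** x.
Proof. by move=> ee; rewrite smulA ee. Qed.

Lemma s_st_sE a : a ** (st a ** a) = a.
Proof. by rewrite smulA smul_st_s. Qed.

Lemma s_st_sK a x : a ** (st a ** (a ** x)) = a ** x.
Proof. by rewrite !smulA smul_st_s. Qed.

Lemma st_s_stE a : st a ** (a ** st a) = st a.
Proof. by rewrite smulA st_smul_st. Qed.

Lemma st_s_stK a x : st a ** (a ** (st a ** x)) = st a ** x.
Proof. by rewrite !smulA st_smul_st. Qed.

(* [f (e f)^* e] is again an inverse of [e f], so uniqueness makes [(e f)^*] idempotent. *)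
Lemma idem_mul e f : idem e -> idem f -> idem (e ** f).
Proof.
move=> ee ff; set a := st (e ** f).
have A1 : e ** (f ** (a ** (e ** f))) = e ** f.
  by have := s_st_sE (e ** f); rewrite -/a -!smulA.
have A2 x : a ** (e ** (f ** (a ** x))) = a ** x.
  by have := st_s_stK (e ** f) x; rewrite -/a -!smulA.
have E : f ** (a ** e) = a.
  by apply: st_uniq; rewrite -!smulA !(idemK _ ff, idemK _ ee) ?A1 ?A2.
have aa : idem a by rewrite /Defs.idem/= -E -!smulA A2.
by rewrite -[e ** f]stK -/a st_idem.
Qed.

Lemma idemC e f : idem e -> idem f -> e ** f = f ** e.
Proof.
move=> ee ff; have i1 := idem_mul ee ff; have i2 := idem_mul ff ee.
rewrite -[e ** f](st_idem i1); symmetry; apply: st_uniq.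
  by rewrite -!smulA !(idemK _ ff, idemK _ ee) smulA.
by rewrite -!smulA !(idemK _ ff, idemK _ ee) smulA.
Qed.

Lemma idemCA e f x : idem e -> idem f -> e ** (f ** x) = f ** (e ** x).
Proof. by move=> ee ff; rewrite smulA (idemC ee ff) -smulA. Qed.

(** The idempotents [b ** st b] and [st a ** a] meet in the middle of the product; after commuting,
    each is absorbed by its neighbour. *)
Lemma stM a b : st (a ** b) = st b ** st a.
Proof.
symmetry; apply: st_uniq; rewrite -!smulA.
  rewrite (smulA b) (smulA (st a)) (idemCA _ (idem_s_st b) (idem_st_s a)).
  by rewrite -!smulA s_st_sE s_st_sK.
rewrite (smulA (st a)) (smulA b) (idemCA _ (idem_st_s a) (idem_s_st b)).
by rewrite -!smulA st_s_stE st_s_stK.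
Qed.

Lemma idem_conj s e : idem e -> idem (s ** e ** st s).
Proof.
move=> ee; rewrite /Defs.idem/= -!smulA (smulA (st s)).
by rewrite (idemCA _ ee (idem_st_s s)) idemK // -!smulA s_st_sK.
Qed.

Lemma leE_trans x y w : leE mul x y -> leE mul y w -> leE mul x w.
Proof. by rewrite /leE => xy yw; rewrite {1}xy {1}yw smulA -xy. Qed.

Lemma leE_mulr x y : idem y -> leE mul (x ** y) y.
Proof. by rewrite /leE -smulA => ->. Qed.

(** * Filters of idempotents *)

Section Filters.
Variable F : set T.
Hypothesis FF : is_filter mul F.

Lemma filter_idem x : F x -> idem x. Proof. by case: FF => + _ _ _ _; apply. Qed.

Lemma filter_nonempty : exists x, F x. Proof. by case: FF. Qed.

Lemma filter_up x y : F x -> idem y -> leE mul x y -> F y.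
Proof. by case: FF => _ _ _ + _; apply. Qed.

Lemma filter_mul x y : F x -> F y -> F (x ** y).
Proof. by case: FF => _ _ _ _; apply. Qed.

Lemma filter_nz : ~ F z.
Proof.
move=> Fz; case: FF => Fi _ + up _; apply; apply/seteqP; split => // x xx.
by apply: (up z) => //; rewrite /leE smul0s.
Qed.

Lemma filter_neqz x : F x -> x <> z.
Proof. by move=> + xz; rewrite xz; exact: filter_nz. Qed.

End Filters.

(** Avoiding [z] is the form of properness that is easy to verify for constructed filters. *)
Lemma is_filterI F : F `<=` idem -> (exists x, F x) -> ~ F z ->
  (forall x y, F x -> idem y -> leE mul x y -> F y) ->
  (forall x y, F x -> F y -> F (x ** y)) -> is_filter mul F.
Proof. by move=> F1 F2 Fz F3 F4; split => // E; apply: Fz; rewrite E; exact: idem_z. Qed.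

Lemma ultrafilter_tight u : is_ultrafilter mul u -> is_tight mul u.
Proof. by move=> Uu; split; [case: Uu|move=> X Y *; exists u]. Qed.

(* The upward closure of [t xi t^*], when [xi] contains [t^* t]. *)
Definition conjf (t : T) (xi : set T) : set T :=
  [set y | idem y /\ xi (st t ** y ** t)].

(** * Conjugation of filters by a semigroup element *)

Section Conjugation.
Variable t : T.

Lemma st_conj e : idem e -> idem (st t ** e ** t).
Proof. by move=> ee; have := idem_conj (st t) ee; rewrite stK. Qed.

Lemma conjf_s_st xi : xi (st t ** t) -> conjf t xi (t ** st t).
Proof. by split; [exact: idem_s_st|rewrite -!smulA s_st_sE]. Qed.

(** The map sending [y] to [st t ** y ** t] is multiplicative on idempotents, because [t ** st t]
    commutes past them and is absorbed, and it fixes [z]; so the filter axioms pull back along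
    it. *)
Lemma conjf_filter xi : is_filter mul xi -> xi (st t ** t) -> is_filter mul (conjf t xi).
Proof.
move=> Fxi xit; apply: is_filterI.
- by move=> y [].
- by exists (t ** st t); exact: conjf_s_st.
- by move=> [_]; rewrite smuls0 smul0s; exact: filter_nz.
- move=> x y [xx xi_x] yy xy; split=> //; apply: (filter_up Fxi xi_x); first exact: st_conj.
  rewrite /leE -!smulA (smulA t) (idemCA _ (idem_s_st t) yy) (smulA x) -xy.
  by rewrite -!smulA s_st_sE.
- move=> x y [xx xi_x] [yy xi_y]; split; first exact: idem_mul.
  have := filter_mul Fxi xi_x xi_y.
  by rewrite -!smulA (smulA t) (idemCA _ (idem_s_st t) yy) -!smulA s_st_sE.
Qed.

(** Conjugating forth and back multiplies by [st t ** t], an element of [xi], which does not affect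
    membership in [xi]. *)
Lemma conjfK xi : is_filter mul xi -> xi (st t ** t) -> conjf (st t) (conjf t xi) = xi.
Proof.
move=> Fxi xit; apply/seteqP; split => y; rewrite /conjf/= stK.
  move=> [yy [_ h]]; apply: (filter_up Fxi h) => //.
  rewrite -!smulA (smulA (st t)) (idemCA _ (idem_st_s t) yy).
  rewrite -!smulA s_st_sE (idemC yy (idem_st_s t)).
  exact: leE_mulr.
move=> xiy; have yy := filter_idem Fxi xiy.
split=> //; split; first exact: idem_conj.
have := filter_mul Fxi (filter_mul Fxi xit xiy) xit.
by rewrite -!smulA.
Qed.

Lemma conjf_sub xi eta : xi `<=` eta -> conjf t xi `<=` conjf t eta.
Proof. by move=> h y [yy /h]. Qed.

End Conjugation.

(** A filter above [conjf t u] also contains [t ** st t], so it can be conjugated back by [st t] to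
    a filter above [u]. *)
Lemma conjf_ultra t u : is_ultrafilter mul u -> u (st t ** t) ->
  is_ultrafilter mul (conjf t u).
Proof.
move=> [Fu mu] ut; split; first exact: conjf_filter.
move=> F' FF' sub.
have F't : F' (t ** st t) by apply: sub; exact: conjf_s_st.
have F't' : F' (st (st t) ** st t) by rewrite stK.
rewrite -[F'](@conjfK (st t)) // stK; congr (conjf _ _).
apply: mu; first exact: conjf_filter.
by rewrite -[X in X `<=` _](@conjfK t) //; exact: conjf_sub.
Qed.

Lemma conjf_tight t xi : is_tight mul xi -> xi (st t ** t) -> is_tight mul (conjf t xi).
Proof.
move=> [Fxi Txi] xit; split; first exact: conjf_filter.
move=> X Y fX fY Yi Xxi Yxi.
pose c y := st t ** y ** t.
(* The extra condition [st t ** t] ensures that the ultrafilter found can itself be conjugated by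
   [t]. *)
have [|||||u [Uu Xu Yu]] := Txi (c @` X `|` [set st t ** t]) (c @` Y).
- by rewrite finite_setU; split; [exact: finite_image|exact: finite_set1].
- exact: finite_image.
- by move=> _ [w Yw <-]; apply: st_conj; exact: Yi.
- by move=> _ [[x Xx <-]|->//]; case: (Xxi _ Xx).
- by move=> _ [y Yy <-] h; apply: (Yxi y Yy); split => //; exact: Yi.
have ut : u (st t ** t) by apply: Xu; right.
exists (conjf t u); split; first exact: conjf_ultra.
  by move=> x Xx; split; [case: (Xxi _ Xx)|apply: Xu; left; exists x].
by move=> y Yy [_ h]; apply: (Yu (c y)) h; exists y.
Qed.

(** * Topology of the tight spectrum *)

Lemma basicT_open X Y : finite_set X -> finite_set Y -> Y `<=` idem ->
  openT mul (basicT mul X Y).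
Proof. by move=> fX fY Yi; split; [move=> xi []|move=> xi h; exists X, Y; split]. Qed.

Lemma basicTU X Y X' Y' :
  basicT mul (X `|` X') (Y `|` Y') = basicT mul X Y `&` basicT mul X' Y'.
Proof.
apply/seteqP; split => xi.
  move=> [txi Xxi Yxi]; split; split => // y h.
  - by apply: Xxi; left.
  - by apply: Yxi; left.
  - by apply: Xxi; right.
  - by apply: Yxi; right.
move=> [[txi h1 h2] [_ h3 h4]]; split => //; first by move=> x [/h1|/h3].
by move=> y [/h2|/h4].
Qed.

Lemma openT_V x : openT mul (V mul x).
Proof.
have -> : V mul x = basicT mul [set x] set0.
  apply/seteqP; split => xi; first by move=> [txi xix]; split => // y ->.
  by move=> [txi h _]; split => //; exact: h.
exact: basicT_open.
Qed.

Lemma openT_notV x : idem x -> openT mul (Tight mul `\` V mul x).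
Proof.
move=> xx.
have -> : Tight mul `\` V mul x = basicT mul set0 [set x].
  apply/seteqP; split => xi; first by move=> [txi nxi]; split => // y -> h; apply: nxi.
  by move=> [txi _ h]; split => // -[_]; exact: h.
by apply: basicT_open => // y ->.
Qed.

Lemma compactT_closed_sub K C : compactT mul K -> C `<=` K -> K `<=` Tight mul ->
  openT mul (Tight mul `\` C) -> compactT mul C.
Proof.
move=> cK CK Kt oC I U oU CU.
have [|xi Kxi|J [fJ KJ]] :=
  cK (option I) (fun o => if o is Some i then U i else Tight mul `\` C).
- by case.
- have [Cxi|nC] := pselect (C xi); last by exists None => //; split => //; exact: Kt.
  by have [i _ Ui] := CU _ Cxi; exists (Some i).
exists (Some @^-1` J); split.
  by apply: finite_preimage => // ? ? _ _ [].
move=> xi Cxi; have [[i|] Ji /=] := KJ _ (CK _ Cxi); first by exists i.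
by case.
Qed.

(* Compact sets are closed since tight filters are separated by clopen sets [V y]. *)
Lemma compactT_closed K : compactT mul K -> K `<=` Tight mul ->
  openT mul (Tight mul `\` K).
Proof.
move=> cK Kt; split; first by move=> ? [].
move=> eta [teta nK].
pose U y := if pselect (idem y) then
  (if pselect (eta y) then Tight mul `\` V mul y else V mul y) else set0.
have [y|xi Kxi|J [fJ KJ]] := cK T U.
- rewrite /U; case: pselect => yy; last by split.
  by case: pselect => ey; [exact: openT_notV|exact: openT_V].
- apply: contrapT => nU; apply: nK; suff -> : eta = xi by [].
  apply/seteqP; split => y h; apply: contrapT => h'; apply: nU; exists y => //.
    rewrite /U; case: pselect => [yy|]; last by case: teta => [[/(_ _ h)]].
    by case: pselect => // ey; split; [exact: Kt|move=> []].
  have txi := Kt _ Kxi.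
  rewrite /U; case: pselect => [yy|]; last by case: txi => [[/(_ _ h)]].
  by case: pselect => // ey; split.
exists (J `&` eta), (J `&` (idem `\` eta)); split.
- exact: finite_setIl.
- exact: finite_setIl.
- by move=> y [_ []].
- by split => [//|y []|y [_ [_ ]]].
move=> xi [txi h1 h2]; split => // Kxi; have [y Jy] := KJ _ Kxi.
rewrite /U; case: pselect => // yy; case: pselect => ey.
  by move=> [_]; apply; split => //; apply: h1; split.
by move=> [_]; apply: h2; split.
Qed.

Lemma compactT_bigcup (I : Type) (D : set I) (K : I -> set (set T)) :
  finite_set D -> (forall i, D i -> compactT mul (K i)) ->
  compactT mul (\bigcup_(i in D) K i).
Proof.
move=> fD cK L U oU KU.
have /choice [J HJ] : forall i, exists J : set L, D i ->
    finite_set J /\ K i `<=` \bigcup_(l in J) U l.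
  move=> i; have [Di|] := pselect (D i); last by exists set0.
  have [|J ?] := cK i Di L U oU; last by exists J.
  by move=> xi Kxi; apply: KU; exists i.
exists (\bigcup_(i in D) J i); split.
  by apply: bigcup_finite => // i /HJ[].
move=> xi [i Di Kxi]; have [_ /(_ _ Kxi)[l Jl Ul]] := HJ i Di.
by exists l => //; exists i.
Qed.

(* The limit of an ultrafilter on [set T] containing [V x] is read off
   idempotent by idempotent. *)
Lemma compactT_V x : idem x -> compactT mul (V mul x).
Proof.
move=> xx I U oU VU; apply: contrapT => nJ.
pose W (J : set I) := V mul x `\` \bigcup_(i in J) U i.
pose F : set_system (set T) := [set A | exists J, finite_set J /\ W J `<=` A].
have PF : ProperFilter F.
  split.
    move=> [J [fJ WJ]]; apply: nJ; exists J; split => // xi Vxi.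
    by apply: contrapT => nU; exact: (WJ xi).
  split.
  - by exists set0; split.
  - move=> A B [J [fJ WJ]] [K [fK WK]]; exists (J `|` K); split.
      by rewrite finite_setU.
    move=> xi [Vxi nU]; split; [apply: WJ|apply: WK]; split => // -[i Ji Ui].
      by apply: nU; exists i => //; left.
    by apply: nU; exists i => //; right.
  - by move=> A B AB [J [fJ WJ]]; exists J; split => // ? /WJ/AB.
have [H [UH FH]] := ultraFilterLemma PF.
have HV : H (V mul x) by apply: FH; exists set0; split => // xi [].
pose xi0 := [set y | idem y /\ H [set xi | xi y]].
(* Since [H]-large sets are nonempty, each basic neighbourhood of [xi0] then contains a tight
   filter, hence meets the ultrafilters; the same fact later puts an open set [U i] around [xi0]
   into [H]. *)
have Hfin X Y : finite_set X -> finite_set Y -> Y `<=` idem -> X `<=` xi0 ->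
    (forall y, Y y -> ~ xi0 y) -> H (basicT mul X Y).
  move=> fX fY Yi Xxi Yxi.
  have HX : H (\bigcap_(y in X) [set xi | xi y]).
    by apply: filter_bigcap => // y /Xxi[].
  have HY : H (\bigcap_(y in Y) [set xi | ~ xi y]).
    apply: filter_bigcap => // y Yy.
    case: (in_ultra_setVsetC [set xi | xi y] UH) => // Hy.
    by exfalso; apply: (Yxi y Yy); split => //; exact: Yi.
  apply: filterS (filterI HV (filterI HX HY)) => xi [[txi _] [hX hY]].
  by split.
have txi0 : is_tight mul xi0.
  split.
    apply: is_filterI.
    - by move=> y [].
    - by exists x; split => //; apply: filterS HV => xi [].
    - move=> [_ Hz]; have [xi [[[Fxi _] _] xiz]] := filter_ex (filterI HV Hz).
      exact: (filter_nz Fxi xiz).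
    - move=> y w [yy Hy] ww yw; split => //.
      apply: filterS (filterI HV Hy) => xi [[[Fxi _] _] xiy].
      exact: (filter_up Fxi xiy).
    - move=> y w [yy Hy] [ww Hw]; split; first exact: idem_mul.
      apply: filterS (filterI HV (filterI Hy Hw)) => xi [[[Fxi _] _] [xiy xiw]].
      exact: (filter_mul Fxi).
  move=> X Y fX fY Yi Xxi Yxi.
  have [xi [[Fxi Txi] hX hY]] := filter_ex (Hfin _ _ fX fY Yi Xxi Yxi).
  exact: Txi.
have Vxi0 : V mul x xi0.
  by split => //; split => //; apply: filterS HV => xi [].
have [i _ Ui] := VU _ Vxi0.
have [_ /(_ _ Ui)[X [Y [fX fY Yi [_ Xxi Yxi] sub]]]] := oU i.
have HU : H (U i) by apply: filterS (Hfin _ _ fX fY Yi Xxi Yxi).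
have HW : H (W [set i]) by apply: FH; exists [set i]; split.
have [xi [Uxi [_ nU]]] := filter_ex (filterI HU HW).
by apply: nU; exists i.
Qed.

End InverseSemigroupTheory.

(** * The partial action on tight filters *)

Section GradedAlgebra.
Local Open Scope ring_scope.
Variables (T : Type) (mul : T -> T -> T) (st : T -> T) (z : T).
Variables (G : groupType) (phi : T -> G) (R : comPzRingType).
Hypothesis HS : is_inv_semigroup0 mul st z.
Hypothesis HG : pure_grading mul z phi.

Local Notation "a ** b" := (mul a b) (at level 40, left associativity).
Local Notation idem := (idem mul).
Local Notation theta := (theta mul st z phi).
Local Notation Dgr := (Dgr mul st z phi).
Local Notation Lc := (Lc mul st z phi).
Local Notation inL := (inL mul st z phi).
Local Notation mulL := (mulL mul st z phi).
Local Notation cjf := (conjf mul st).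
Local Notation tight := (is_tight mul).

Implicit Types (g s : G) (t x y : T) (xi eta : set T) (f : set T -> R).

Lemma phiM a b : a ** b <> z -> phi (a ** b) = monoid.mul (phi a) (phi b).
Proof. by case: HG => + _; apply. Qed.

Lemma phi_idem e : e <> z -> idem e -> phi e = monoid.one.
Proof. by case: HG => _ h ez ee; apply/h. Qed.

Lemma idem_phi e : e <> z -> phi e = monoid.one -> idem e.
Proof. by case: HG => _ h ez /h; apply. Qed.

Lemma phi_st t : t <> z -> phi (st t) = monoid.inv (phi t).
Proof.
move=> tz; have nz : t ** st t <> z.
  by move=> E; apply: tz; rewrite -(smul_st_s HS t) E (smul0s HS).
by symmetry; apply: mulg1_eq; rewrite -phiM // phi_idem //; exact: idem_s_st HS _.
Qed.

Lemma filter_s_st_neqz xi t : is_filter mul xi -> xi (t ** st t) -> t <> z.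
Proof.
by move=> Fxi xit tz; apply: (filter_neqz HS Fxi xit); rewrite tz (smul0s HS).
Qed.

(* Purity: [t e u^*] is a nonzero element of degree 1, hence an idempotent,
   and both sides are equal to it. *)
Lemma conj_phi t u e : idem e -> e <> z -> phi t = phi u ->
  leE mul e (st t ** t) -> leE mul e (st u ** u) ->
  t ** e ** st t = u ** e ** st u.
Proof.
move=> ee ez tu et eu.
have et' : st t ** (t ** e) = e by rewrite (smulA HS) (idemC HS (idem_st_s HS t) ee).
have eu' : st u ** (u ** e) = e by rewrite (smulA HS) (idemC HS (idem_st_s HS u) ee).
have nz : t ** (e ** st u) <> z.
  move=> E; apply: ez.
  by rewrite {1}eu -{1}et' (smulA HS) -!(smulA HS) (smulA HS e) (smulA HS t) E
    (smul0s HS) (smuls0 HS).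
have nz' : e ** st u <> z by move=> E; apply: nz; rewrite E (smuls0 HS).
have uz : st u <> z by move=> E; apply: nz'; rewrite E (smuls0 HS).
have uz' : u <> z by move=> E; apply: nz'; rewrite eu E (smuls0 HS) (smuls0 HS) (smul0s HS).
have ff : idem (t ** (e ** st u)).
  apply: idem_phi => //; rewrite phiM // phiM // (phi_idem ez ee) mul1g phi_st //.
  by rewrite tu mulgV.
have fE := st_idem HS ff.
have fE' : t ** (e ** st u) = u ** (e ** st t).
  by rewrite -fE !(stM HS) (stK HS) (st_idem HS ee) -(smulA HS).
rewrite -!(smulA HS); transitivity (t ** (e ** st u)).
  rewrite -ff {2}fE' -!(smulA HS) (smulA HS (st u)) (smulA HS (st u ** u)).
  by rewrite -(smulA HS (st u)) eu' (idemK HS).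
rewrite -ff {1}fE' -!(smulA HS) (smulA HS (st t)) (smulA HS (st t ** t)).
by rewrite -(smulA HS (st t)) et' (idemK HS).
Qed.

(** Two witnesses of the same degree agree, by [conj_phi], on any nonzero idempotent below both of
    their domains, and a filter always contains such an idempotent. *)
Lemma theta_conj xi t : is_filter mul xi -> xi (st t ** t) ->
  theta (phi t) xi = cjf t xi.
Proof.
move=> Fxi xit.
have tz : t <> z.
  by move=> tz; apply: (filter_neqz HS Fxi xit); rewrite tz (smuls0 HS).
apply/seteqP; split => y.
  move=> [yy [x [u [xix uz ut xu uy]]]]; split => //.
  have xx := filter_idem Fxi xix.
  have tt := idem_st_s HS t.
  (* [e] lies in [xi], below the domains of both [t] and [u], so [conj_phi] compares them on it. *)
  pose e := x ** (st t ** t).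
  have xie : xi e by exact: (filter_mul Fxi).
  have ee := filter_idem Fxi xie.
  have et : leE mul e (st t ** t) by exact: (leE_mulr HS).
  have ex : leE mul e x by rewrite /e (idemC HS xx tt); exact: (leE_mulr HS).
  clearbody e; have E := conj_phi ee (filter_neqz HS Fxi xie) (esym ut) et (leE_trans HS ex xu).
  apply: (filter_up Fxi xie); first exact: (st_conj HS).
  have uxy : u ** e ** st u = u ** e ** st u ** y.
    have exE : e = e ** x by [].
    have uxe : u ** e ** st u ** (u ** x ** st u) = u ** e ** st u.
      rewrite -!(smulA HS) (smulA HS (st u)) (idemCA HS _ ee (idem_st_s HS u)).
      by rewrite (smulA HS e) -exE -!(smulA HS) (s_st_sK HS).
    by rewrite -[LHS]uxe uy (smulA HS (u ** e ** st u)) uxe.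
  have et' : st t ** (t ** e) = e by rewrite (smulA HS) (idemC HS tt ee).
  (* [f] is below [y]; conjugating it back by [t] returns [e], so [e] is below [st t ** y ** t]. *)
  pose f := t ** e ** st t.
  have fy : f ** y = f by rewrite /f E -uxy.
  have ftK w : f ** (t ** (st t ** w)) = f ** w.
    by rewrite /f -!(smulA HS) (st_s_stK HS).
  have E2 : st t ** (f ** t) = e by rewrite /f -!(smulA HS) -et et'.
  clearbody f; rewrite /leE -{2}E2 -!(smulA HS) ftK (smulA HS f) fy.
  by rewrite E2.
move=> [yy xiy]; split => //; exists (st t ** y ** t), t; split => //.
  by rewrite /leE -!(smulA HS) (s_st_sE HS).
have tt := idem_s_st HS t.
rewrite -!(smulA HS) (idemC HS yy tt) -!(smulA HS) (s_st_sK HS) (smulA HS).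
exact: (leE_mulr HS).
Qed.

(** A filter is upward closed and misses [z], so its witness in [Egr g] can be taken to be
    [t ** st t]. *)
Lemma DgrP g xi : Dgr g xi <-> tight xi /\ exists t, phi t = g /\ xi (t ** st t).
Proof.
split=> [[txi [x [[xz|[xx [t [tz tg xt]]]] xix]]]|[txi [t [tg xit]]]].
- by rewrite xz in xix; case: (filter_nz HS (proj1 txi)).
- split => //; exists t; split => //; apply: (filter_up (proj1 txi) xix) => //.
  exact: idem_s_st HS _.
split=> //; exists (t ** st t); split => //; right; split; first exact: (idem_s_st HS).
exists t; split => //; first exact: filter_s_st_neqz (proj1 txi) xit.
by rewrite /leE (idem_s_st HS).
Qed.

(** Any idempotent of the filter has degree 1 and may serve as the conjugating element. The lemma is
    stated for all filters so that it covers [star set0], tight or not. *)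
Lemma theta1 xi : is_filter mul xi -> theta monoid.one xi = xi.
Proof.
move=> Fxi; have [e xie] := filter_nonempty Fxi.
have ee := filter_idem Fxi xie; have ez := filter_neqz HS Fxi xie.
have eE : st e ** e = e by rewrite (st_idem HS ee).
rewrite -(phi_idem ez ee) theta_conj ?eE //; apply/seteqP; split => y.
  rewrite /conjf/= (st_idem HS ee) => -[yy h]; apply: (filter_up Fxi h) => //.
  by rewrite -(smulA HS) (idemC HS yy ee) (idemK HS) //; exact: (leE_mulr HS).
move=> xiy; split; first exact: filter_idem xiy.
by rewrite (st_idem HS ee); apply: (filter_mul Fxi) => //; apply: (filter_mul Fxi).
Qed.

(** One [t] serves every filter containing [t ** st t], hence a neighbourhood of [eta]; this is the
    continuity of [theta] in usable form. *)
Lemma Dgr_theta g eta : Dgr g eta -> exists t,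
  [/\ phi t = g, eta (t ** st t) & forall xi, is_filter mul xi -> xi (t ** st t) ->
      theta (monoid.inv g) xi = cjf (st t) xi].
Proof.
move=> /DgrP[teta [t [tg etat]]]; exists t; split => // xi Fxi xit.
rewrite -tg -phi_st; last exact: filter_s_st_neqz Fxi xit.
by rewrite theta_conj // (stK HS).
Qed.

Lemma theta_Dgr g eta : Dgr g eta ->
  Dgr (monoid.inv g) (theta (monoid.inv g) eta) /\ theta g (theta (monoid.inv g) eta) = eta.
Proof.
move=> Dg; have teta := proj1 Dg; have [t [tg etat ->//]] := Dgr_theta Dg; last first.
  exact: (proj1 teta).
have Feta := proj1 teta.
have etat' : eta (st (st t) ** st t) by rewrite (stK HS).
have h : cjf (st t) eta (st t ** t).
  by have := conjf_s_st HS etat'; rewrite (stK HS).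
split.
  apply/DgrP; split; first exact: (conjf_tight HS).
  exists (st t); rewrite (stK HS) phi_st ?tg //; exact: filter_s_st_neqz Feta etat.
rewrite -tg theta_conj //; last exact: (conjf_filter HS).
by rewrite -{1}[t](stK HS) (conjfK HS).
Qed.

Lemma Lc_zero g f xi : Lc g f -> ~ tight xi -> f xi = 0%R.
Proof. by case=> h _ _ nt; apply: h => -[]. Qed.

(** * Convolution formula and membership in [Lc] *)

Definition supp (a : G -> set T -> R) : set G := [set g | a g <> (fun _ => 0%R)].

(** On [Dgr s] the inner transport undoes the outer one, as [theta s] inverts [theta (inv s)]; off
    [Dgr s] the coefficient [a s] vanishes. *)
Lemma mulLE (a b : G -> set T -> R) g eta : inL a ->
  mulL a b g eta = \sum_(s \in supp a)
    (a s eta * b (monoid.mul (monoid.inv s) g) (theta (monoid.inv s) eta))%R.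
Proof.
move=> [_ La]; apply: eq_fsbigr => s _; rewrite /transport.
case: asboolP => [Ds|nD]; last by have [-> //] := La s; rewrite mul0r.
have [D' E] := theta_Dgr Ds.
by case: asboolP => // _; rewrite invgK E.
Qed.

Definition locally_constant f := forall xi, tight xi -> exists X Y : set T,
  [/\ finite_set X, finite_set Y, Y `<=` idem, basicT mul X Y xi &
      forall xi', basicT mul X Y xi' -> f xi' = f xi].

Lemma locally_constant_open f : locally_constant f ->
  forall P : set R, openT mul [set xi | tight xi /\ P (f xi)].
Proof.
move=> lcf P; split => [xi []//|xi [txi Pxi]].
have [X [Y [fX fY Yi XY h]]] := lcf _ txi; exists X, Y; split => //.
by move=> xi' B; split; [case: B|rewrite h].
Qed.

(** Level sets of a locally constant function are clopen: finitely many cover [K], which bounds the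
    number of values, and those of nonzero values are closed in [K], hence compact. *)
Lemma Lc_intro g f (K : set (set T)) : (forall xi, ~ Dgr g xi -> f xi = 0) ->
  locally_constant f -> compactT mul K -> K `<=` Tight mul ->
  (forall xi, f xi <> 0 -> K xi) -> Lc g f.
Proof.
move=> f0 lcf cK Kt fK.
have ft xi : f xi <> 0 -> tight xi by move=> /fK/Kt.
split => // [|r r0].
  have [|xi Kxi|J [fJ KJ]] := cK R (fun r => [set xi | tight xi /\ f xi = r]).
  - by move=> r; exact: (locally_constant_open lcf [set r]).
  - by exists (f xi) => //; split => //; exact: Kt.
  apply: sub_finite_set fJ => r [r0 [xi fr]].
  have [|r' Jr' [_ E]] := KJ xi; first by apply: fK; rewrite fr.
  by rewrite -fr E.
have -> : [set xi | f xi = r] = [set xi | tight xi /\ f xi = r].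
  by apply/seteqP; split => xi /=; [move=> E; split => //; apply: ft; rewrite E|case].
split; first exact: (locally_constant_open lcf [set r]).
apply: (compactT_closed_sub cK) => //.
  by move=> xi [_ E]; apply: fK; rewrite E.
have -> : Tight mul `\` [set xi | tight xi /\ f xi = r] =
    [set xi | tight xi /\ (~` [set r]) (f xi)].
  by apply/seteqP; split => xi /= [txi h]; split => // E; apply: h => //; case: E.
exact: locally_constant_open.
Qed.

Lemma Lc_compact g f : Lc g f -> compactT mul [set xi | f xi <> 0].
Proof.
move=> [_ ff cf].
have -> : [set xi | f xi <> 0] =
    \bigcup_(r in [set r | r <> 0 /\ exists xi, f xi = r]) [set xi | f xi = r].
  apply/seteqP; split => xi /=; last by move=> [r [r0 _]] ->.
  by move=> h; exists (f xi) => //; split => //; exists xi.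
by apply: compactT_bigcup => // r [r0 _]; case: (cf r r0).
Qed.

Lemma Lc_neq0_tight g f xi : Lc g f -> f xi <> 0 -> tight xi.
Proof. by move=> Lf h; apply: contrapT => /(Lc_zero Lf). Qed.

(** Where [f] is nonzero its level set is open; at a zero, the support is compact, hence closed, and
    its complement is the neighbourhood. *)
Lemma Lc_locally_constant g f : Lc g f -> locally_constant f.
Proof.
move=> Lf xi txi; have [E|r0] := pselect (f xi = 0); last first.
  case: Lf => _ _ /(_ _ r0)[[_ /(_ xi erefl)[X [Y [? ? ? ? h]]]] _].
  by exists X, Y; split => // xi' /h.
have [|_ /(_ xi)[|X [Y [? ? ? ? h]]]] := compactT_closed (Lc_compact Lf).
- by move=> xi'; exact: Lc_neq0_tight Lf.
- by split.
by exists X, Y; split => // xi' /h[_] /contrapT->.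
Qed.

Lemma Lc0 g : Lc g (fun=> 0 : R).
Proof.
apply: (@Lc_intro _ _ set0) => //; last first.
  by move=> I U _ _; exists set0; split => //; exact: finite_set0.
by move=> xi txi; exists set0, set0; split => //; split.
Qed.

Lemma locally_constant2 (op : R -> R -> R) f f' :
  locally_constant f -> locally_constant f' ->
  locally_constant (fun xi => op (f xi) (f' xi)).
Proof.
move=> lf lf' xi txi.
have [X [Y [fX fY Yi XY h]]] := lf _ txi.
have [X' [Y' [fX' fY' Yi' XY' h']]] := lf' _ txi.
exists (X `|` X'), (Y `|` Y'); rewrite basicTU !finite_setU; split => //.
  by move=> y [/Yi|/Yi'].
by move=> xi' [/h-> /h'->].
Qed.

Lemma LcD g f f' : Lc g f -> Lc g f' -> Lc g (fun xi => f xi + f' xi).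
Proof.
move=> Lf Lf'.
apply: (@Lc_intro _ _ (\bigcup_(b in [set: bool])
  [set xi | (if b then f else f') xi <> 0])).
- by move=> xi nD; case: Lf => -> // _ _; case: Lf' => -> // _ _; rewrite addr0.
- by apply: (locally_constant2 +%R); [exact: Lc_locally_constant Lf|exact: Lc_locally_constant Lf'].
- apply: compactT_bigcup; first exact: finite_finset.
  by move=> [] _; [exact: Lc_compact Lf|exact: Lc_compact Lf'].
- by move=> xi [[] _]; [exact: Lc_neq0_tight Lf|exact: Lc_neq0_tight Lf'].
move=> xi h; have [E|r0] := pselect (f xi = 0); last by exists true.
by exists false => //=; rewrite E add0r in h.
Qed.

Lemma Lc_sum (I : Type) (r : seq I) (F : I -> set T -> R) g :
  (forall i, Lc g (F i)) -> Lc g (fun xi => \sum_(i <- r) F i xi).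
Proof.
move=> LF; elim: r => [|i r IH].
  by under eq_fun do rewrite big_nil; exact: Lc0.
by under eq_fun do rewrite big_cons; exact: LcD.
Qed.

(** If [t] of degree [s] witnesses [Dgr s eta] and [u] of degree [s^-1 g] witnesses the domain of
    the conjugated filter, then [t ** u] has degree [g] and witnesses [Dgr g eta]. The support lies
    in that of [f], so compactness is inherited. *)
Lemma Lc_conv s g f f' : Lc s f -> Lc (monoid.mul (monoid.inv s) g) f' ->
  Lc g (fun eta => f eta * f' (theta (monoid.inv s) eta)).
Proof.
move=> Lf Lf'; apply: (@Lc_intro _ _ [set xi | f xi <> 0]).
- move=> eta nD.
  have [Ds|nDs] := pselect (Dgr s eta); last by case: Lf => -> //; rewrite mul0r.
  have Feta := proj1 (proj1 Ds).
  have [t [ts etat E]] := Dgr_theta Ds; rewrite {}E //.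
  have [D'|nD'] := pselect (Dgr (monoid.mul (monoid.inv s) g) (cjf (st t) eta)); last first.
    by case: Lf' => -> //; rewrite mulr0.
  exfalso; apply: nD; apply/DgrP; split; first exact: (proj1 Ds).
  have [_ [u [us [_ etau]]]] := (DgrP _ _).1 D'.
  move: etau; rewrite (stK HS) => etau.
  have tuE : t ** u ** st (t ** u) = t ** (u ** st u) ** st t.
    by rewrite (stM HS) -!(smulA HS).
  exists (t ** u); rewrite tuE; split => //.
  rewrite phiM; first by rewrite ts us mulVKg.
  by move=> E; apply: (filter_neqz HS Feta etau); rewrite -tuE E (smul0s HS).
- move=> eta teta.
  have [E|r0] := pselect (f eta = 0).
    have [X [Y [? ? ? ? h]]] := Lc_locally_constant Lf teta.
    by exists X, Y; split => // xi' /h->; rewrite E !mul0r.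
  have Ds : Dgr s eta by apply: contrapT => nD; case: Lf => /(_ _ nD).
  have [t [ts etat Et]] := Dgr_theta Ds.
  have tconj : tight (cjf (st t) eta).
    by apply: (conjf_tight HS) => //; rewrite (stK HS).
  have [X [Y [fX fY Yi [_ hX hY] h]]] := Lc_locally_constant Lf teta.
  have [X' [Y' [fX' fY' Yi' [_ hX' hY'] h']]] := Lc_locally_constant Lf' tconj.
  pose c y := t ** y ** st t.
  (* The condition [t ** st t] keeps [theta (inv s)] equal to conjugation by [st t] on the whole
     neighbourhood. *)
  exists (X `|` (c @` X' `|` [set t ** st t])), (Y `|` c @` Y').
  rewrite basicTU !finite_setU; split.
  + split => //; split; [exact: finite_image|exact: finite_set1].
  + by split => //; exact: finite_image.
  + by move=> _ [/Yi//|[y Yy <-]]; apply: (idem_conj HS); exact: Yi'.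
  + split; first by split.
    split => //.
      by move=> _ [[x /hX'[_] + <-]|->//]; rewrite (stK HS).
    move=> _ [y Yy <-] etay; apply: (hY' _ Yy); split; first exact: Yi'.
    by rewrite (stK HS).
  move=> eta' [/h-> [teta' hX2 hY2]].
  have et' : eta' (t ** st t) by apply: hX2; right.
  rewrite (Et _ (proj1 teta')) // (Et _ (proj1 teta)) // h' //; split.
  + by apply: (conjf_tight HS) => //; rewrite (stK HS).
  + move=> x Xx; have [xx _] := hX' _ Xx; split => //.
    by rewrite (stK HS); apply: hX2; left; exists x.
  + by move=> y Yy [_]; rewrite (stK HS) => h2; apply: (hY2 (c y)) => //; exists y.
- exact: Lc_compact Lf.
- by move=> xi; exact: Lc_neq0_tight Lf.
- by move=> xi h E; apply: h; rewrite E mul0r.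
Qed.

Lemma inL_mulL (a b : G -> set T -> R) : inL a -> inL b -> inL (mulL a b).
Proof.
move=> La Lb; have [fa La'] := La; have [fb Lb'] := Lb; split.
  apply: sub_finite_set (finite_image2 monoid.mul fa fb) => g h.
  apply: contrapT => nh; apply: h; apply/funext => eta; rewrite mulLE //.
  apply: fsbig1 => s sa.
  suff -> : b (monoid.mul (monoid.inv s) g) = (fun=> 0) by rewrite mulr0.
  apply: contrapT => hb; apply: nh.
  by exists s => //; exists (monoid.mul (monoid.inv s) g) => //; rewrite mulVKg.
move=> g; have -> : mulL a b g = fun eta => \sum_(s <- finmap.enum_fset (fset_set (supp a)))
    (a s eta * b (monoid.mul (monoid.inv s) g) (theta (monoid.inv s) eta)).
  by apply/funext => eta; rewrite mulLE // fsbig_finite.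
by apply: Lc_sum => s; exact: Lc_conv.
Qed.

(** Enlarging the index set avoids deciding whether a coefficient is zero; [deltaV x g], for
    instance, vanishes over the zero ring. *)
Lemma mulLE_sub (D : set G) (a b : G -> set T -> R) g eta : inL a -> supp a `<=` D ->
  mulL a b g eta = \sum_(s \in D)
    (a s eta * b (monoid.mul (monoid.inv s) g) (theta (monoid.inv s) eta)).
Proof.
move=> La sD; rewrite mulLE //; apply: fsbig_widen => // s [_ /contrapT E] /=.
by rewrite E mul0r.
Qed.

(** * Multiplication by indicator functions *)

Local Notation deltaV := (deltaV mul R).

Lemma supp_deltaV x g : supp (deltaV x g) `<=` [set g].
Proof.
move=> h; apply: contraPP => /eqP/negbTE hg /=; apply.
by apply/funext => xi; rewrite /Defs.deltaV hg.
Qed.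

Lemma inL_deltaV x : idem x -> inL (deltaV x monoid.one).
Proof.
move=> xx; split.
  by apply: sub_finite_set (finite_set1 _); exact: supp_deltaV.
move=> g; rewrite /Defs.deltaV; case: eqP => [->|_]; last exact: Lc0.
have V0 xi : (asbool (V mul x xi))%:R <> 0 :> R -> V mul x xi.
  by case: asboolP.
apply: (@Lc_intro _ _ (V mul x)) => //.
- move=> xi nD; apply: contrapT => /V0[txi xix]; apply: nD; apply/DgrP.
  split => //; exists x; rewrite (st_idem HS xx) xx; split => //.
  by apply: phi_idem => //; exact: (filter_neqz HS (proj1 txi) xix).
- move=> xi txi; have [xix|nxi] := pselect (xi x).
    exists [set x], set0; split => //.
    + by split => // y ->.
    + by move=> xi' [txi' h _]; rewrite !asboolT //; split => //; exact: h.
  exists set0, [set x]; split => //.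
  + by move=> y ->.
  + by split => // y ->.
  + by move=> xi' [txi' _ h]; rewrite !asboolF // => -[_] //; exact: h.
- exact: (compactT_V HS).
- by move=> xi [].
Qed.

Lemma deltaV_mull x (a : G -> set T -> R) g eta : idem x -> inL a ->
  mulL (deltaV x monoid.one) a g eta = (asbool (V mul x eta))%:R * a g eta.
Proof.
move=> xx La; rewrite (mulLE_sub _ _ _ (inL_deltaV xx) (@supp_deltaV _ _)).
rewrite fsbig_set1 /Defs.deltaV eqxx invg1 mul1g.
have [teta|nt] := pselect (tight eta); first by rewrite theta1 //; case: teta.
by rewrite asboolF ?mul0r // => -[].
Qed.

(** On the right the indicator is evaluated at [theta (inv g) eta] instead of [eta]; as [x] lies in
    every tight filter, its value there is 1. *)
Lemma deltaV_mulr x (a : G -> set T -> R) : idem x ->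
  (forall xi, tight xi -> xi x) -> inL a -> mulL a (deltaV x monoid.one) = a.
Proof.
move=> xx xT La; apply/funext => g; apply/funext => eta.
have [fa La'] := La.
(* The index [g] is adjoined because it is the only one that can contribute: elsewhere [s^-1 g] is
   not 1. *)
have sD : supp a `<=` supp a `|` [set g] by move=> s; left.
rewrite (mulLE_sub _ _ _ La sD) (fsbigD1 g); last by right.
  rewrite fsbig1 /= ?addr0.
    rewrite mulVg /Defs.deltaV eqxx.
    have [Dg|nD] := pselect (Dgr g eta); last by case: (La' g) => -> //; rewrite mul0r.
    have [[tt _] _] := theta_Dgr Dg.
    by rewrite asboolT ?mulr1 //; split => //; exact: xT.
  move=> s [_ /= sg]; rewrite /Defs.deltaV; case: eqP => [E|]; last by rewrite mulr0.
  by exfalso; apply: sg; rewrite -[g](mulVKg s) E mulg1.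
by rewrite finite_setU; split => //; exact: finite_set1.
Qed.

End GradedAlgebra.

(** * The semigroup with an identity adjoined *)

Section AdjoinIdentity.
Local Open Scope ring_scope.
Variables (T : Type) (mul : T -> T -> T) (st : T -> T) (z : T).
Variables (G : groupType) (phi : T -> G) (R : comPzRingType).
Hypothesis HS : is_inv_semigroup0 mul st z.
Hypothesis HG : pure_grading mul z phi.
Hypothesis Hne : exists s, s <> z.

Local Notation mulS := (optmul mul).
Local Notation stS := (optstar st).
Local Notation zS := (Some z).
Local Notation phiS := (optphi phi).
Local Notation theta := (theta mul st z phi).
Local Notation thetaS := (Defs.theta mulS stS zS phiS).
Local Notation Dgr := (Dgr mul st z phi).
Local Notation DgrS := (Defs.Dgr mulS stS zS phiS).
Local Notation Lc := (Lc mul st z phi).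
Local Notation LcS := (Defs.Lc mulS stS zS phiS).
Local Notation inL := (inL mul st z phi).
Local Notation inLS := (Defs.inL mulS stS zS phiS).

Lemma opt_inv_semigroup0 : is_inv_semigroup0 mulS stS zS.
Proof.
split.
- by move=> [a|] [b|] [c|] //=; rewrite (smulA HS).
- by move=> [a|] //=; rewrite (smul0s HS) (smuls0 HS).
- by move=> [a|] //=; rewrite (smul_st_s HS) (st_smul_st HS).
- move=> [a|] [b|] //= [h1] [h2].
  by congr Some; exact: (st_uniq HS).
Qed.
Let HS' := opt_inv_semigroup0.

Lemma idem_Some x : idem mulS (Some x) <-> idem mul x.
Proof. by rewrite /idem/=; split => [[]|->]. Qed.

Lemma leE_Some x y : leE mulS (Some x) (Some y) <-> leE mul x y.
Proof. by rewrite /leE/=; split => [[]|<-]. Qed.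

Lemma opt_pure_grading : pure_grading mulS zS phiS.
Proof.
split.
  move=> [a|] [b|] //= h; rewrite ?mulg1 ?mul1g //.
  by apply: (phiM HG) => E; apply: h; rewrite E.
move=> [a|] //= h; rewrite idem_Some; case: HG => _; apply => E; apply: h.
by rewrite E.
Qed.
Let HG' := opt_pure_grading.

(** The new idempotent [None] is not below any [Some x], so there is nothing new to be met by a
    cover. *)
Lemma opt_fincover x Z : is_fincover mul z x Z ->
  is_fincover mulS zS (Some x) (Some @` Z).
Proof.
move=> [fZ Zi Zx cov]; split.
- exact: finite_image.
- by move=> _ [w Zw <-]; apply/idem_Some; exact: Zi.
- by move=> _ [w Zw <-]; apply/leE_Some; exact: Zx.
move=> [y|] // /idem_Some yy yz /leE_Some yx.
have [|w [Zw yw]] := cov y yy _ yx; first by move=> E; apply: yz; rewrite E.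
by exists (Some w); split; [exists w|case].
Qed.

(** * Comparison of filters and of the partial actions *)

Definition star (F : set T) : set (option T) :=
  [set o | if o is Some x then F x else True].

Lemma star_pre (eta : set (option T)) : eta None -> star (Some @^-1` eta) = eta.
Proof. by move=> h; apply/seteqP; split => -[x|]. Qed.

Lemma star_inj F F' : star F = star F' -> F = F'.
Proof. by move=> E; rewrite -[F]/(Some @^-1` star F) E. Qed.

Lemma filter_star F : is_filter mul F -> is_filter mulS (star F).
Proof.
move=> FF; apply: (is_filterI HS').
- by move=> [x|] //= /(filter_idem FF) ?; apply/idem_Some.
- by exists None.
- exact: (filter_nz HS FF).
- move=> [x|] [y|] //= Fx /idem_Some yy /leE_Some xy.
  exact: (filter_up FF Fx).
- by move=> [x|] [y|] //=; exact: (filter_mul FF).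
Qed.

Lemma filterS_None eta : is_filter mulS eta -> eta None.
Proof.
move=> FF; have [x etax] := filter_nonempty FF.
by apply: (filter_up FF etax) => //; case: (x).
Qed.

Lemma filterS_pre eta x : is_filter mulS eta -> eta (Some x) ->
  is_filter mul (Some @^-1` eta).
Proof.
move=> FF etax; apply: (is_filterI HS).
- by move=> y /(filter_idem FF)/idem_Some.
- by exists x.
- exact: (filter_nz HS' FF).
- move=> y w etay ww yw; apply: (filter_up FF etay); first exact/idem_Some.
  exact/leE_Some.
- by move=> y w; exact: (filter_mul FF).
Qed.

Lemma ultra_star u : is_ultrafilter mul u -> is_ultrafilter mulS (star u).
Proof.
move=> [Fu mu]; split; first exact: filter_star.
move=> F' FF' sub; have [x ux] := filter_nonempty Fu.
rewrite -(star_pre (filterS_None FF')); congr star; apply: mu.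
  by apply: (filterS_pre FF' (x := x)); exact: sub.
by move=> y uy; exact: sub.
Qed.

Lemma ultraS_pre u : is_ultrafilter mulS u ->
  exists2 v, is_ultrafilter mul v & u = star v.
Proof.
move=> [Fu mu]; have [[x ux]|nu] := pselect (exists x, u (Some x)).
  have uN := star_pre (filterS_None Fu).
  exists (Some @^-1` u) => //; split; first exact: filterS_pre Fu ux.
  move=> F' FF' sub; apply: star_inj; rewrite uN.
  apply: mu; first exact: filter_star.
  by rewrite -uN => -[y|] //; exact: sub.
(* The principal filter of the nonzero idempotent [e] gives a filter strictly larger than [{None}],
   contradicting maximality. *)
exfalso; have [s sz] := Hne; pose e := mul s (st s).
have ee : idem mul e := idem_s_st HS s.
have ez : e <> z by move=> E; apply: sz; rewrite -(smul_st_s HS s) -/e E (smul0s HS).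
pose P := star [set x | idem mul x /\ leE mul e x].
have FP : is_filter mulS P.
  apply: filter_star; apply: (is_filterI HS).
  - by move=> y [].
  - by exists e; split => //; rewrite /leE ee.
  - by move=> [_]; rewrite /leE (smuls0 HS).
  - by move=> x y [xx ex] yy xy; split => //; exact: (leE_trans HS ex xy).
  - move=> x y [xx ex] [yy ey]; split; first exact: (idem_mul HS).
    by rewrite /leE (smulA HS) -ex -ey.
apply: (nu); exists e; rewrite -(mu P FP); last first.
  by move=> [x|] // ux; case: nu; exists x.
by split => //; rewrite /leE ee.
Qed.

Lemma finite_preSome (X : set (option T)) : finite_set X -> finite_set (Some @^-1` X).
Proof. by move=> fX; apply: finite_preimage => // ? ? _ _ []. Qed.

Lemma tight_star F : is_tight mul F -> is_tight mulS (star F).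
Proof.
move=> [FF TF]; split; first exact: filter_star.
move=> X Y fX fY Yi XF YF.
have [|||||u [Uu Xu Yu]] := TF (Some @^-1` X) (Some @^-1` Y).
- exact: finite_preSome.
- exact: finite_preSome.
- by move=> y /Yi/idem_Some.
- by move=> x /XF.
- by move=> y /YF.
exists (star u); split; first exact: ultra_star.
  by move=> [x|] //; exact: Xu.
by move=> [y|] // Yy; [exact: Yu|case: (YF _ Yy)].
Qed.

Lemma tight_pre eta x : is_tight mulS eta -> eta (Some x) ->
  is_tight mul (Some @^-1` eta).
Proof.
move=> [Feta Teta] etax; split; first exact: filterS_pre Feta etax.
move=> X Y fX fY Yi XF YF.
have [|||||u [Uu Xu Yu]] := Teta (Some @` X) (Some @` Y).
- exact: finite_image.
- exact: finite_image.
- by move=> _ [y /Yi ? <-]; exact/idem_Some.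
- by move=> _ [y /XF ? <-].
- by move=> _ [y /YF ? <-].
have [v Uv E] := ultraS_pre Uu; exists v; split => //.
  by move=> y Xy; have : u (Some y) by [apply: Xu; exists y]; rewrite E.
by move=> y Yy vy; apply: (Yu (Some y)); [exists y|rewrite E].
Qed.

Variant tightS_spec (eta : set (option T)) : Prop :=
  | TightInfty of eta = star set0
  | TightStar F of is_tight mul F & eta = star F.

Lemma tightSP eta : is_tight mulS eta -> tightS_spec eta.
Proof.
move=> teta; have uN := star_pre (filterS_None (proj1 teta)).
have [[x ux]|nu] := pselect (exists x, eta (Some x)).
  by apply: (@TightStar _ (Some @^-1` eta)) => //; exact: tight_pre teta ux.
apply: TightInfty; rewrite -uN; congr star; apply/seteqP; split => // y etay.
by apply: nu; exists y.
Qed.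

Lemma Dgr_star g F : Dgr g F -> DgrS g (star F).
Proof.
move=> /(DgrP _ HS)[tF [t [tg Ft]]]; apply/(DgrP _ HS').
by split; [exact: tight_star|exists (Some t)].
Qed.

(** Only [t = None] has [t t^*] in [star set0], and its degree is 1. *)
Lemma DgrS_infty g : DgrS g (star set0) -> g = monoid.one.
Proof. by move=> /(DgrP _ HS')[_ [[t|] [tg //]]]. Qed.

Lemma DgrS_star g F : is_tight mul F -> DgrS g (star F) -> Dgr g F.
Proof.
move=> tF /(DgrP _ HS')[_ [[t|] [tg /= Ft]]]; apply/(DgrP _ HS); split => //.
  by exists t.
(* The witness is [None], so [g] is 1, and any idempotent of [F] can replace it. *)
have [e Fe] := filter_nonempty (proj1 tF); have ee := filter_idem (proj1 tF) Fe.
exists e; rewrite (st_idem HS ee) ee; split => //; rewrite -tg.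
exact: (phi_idem HG (filter_neqz HS (proj1 tF) Fe) ee).
Qed.

Lemma theta_star g F : Dgr g F ->
  thetaS (monoid.inv g) (star F) = star (theta (monoid.inv g) F).
Proof.
move=> DF; have FF := proj1 (proj1 DF).
have [t [tg Ft ->//]] := Dgr_theta HS HG DF.
have tz := filter_s_st_neqz HS FF Ft.
rewrite -tg -(phi_st HS HG tz) -[phi (st t)]/(phiS (Some (st t))).
rewrite (theta_conj HS' HG'); last 2 first.
- exact: filter_star.
- by rewrite /= (stK HS).
apply/seteqP; split => -[y|] //=; rewrite /conjf/= ?idem_Some //.
by move=> _; split => //; rewrite (stK HS).
Qed.

(** * Transfer of open and compact sets along [star] *)

Lemma openT_star U : openT mul U -> openT mulS (star @` U).
Proof.
move=> [Ut oU]; split; first by move=> _ [F /Ut tF <-]; exact: tight_star.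
move=> _ [F UF <-]; have tF := Ut _ UF.
have [X [Y [fX fY Yi [_ XF YF] sub]]] := oU _ UF.
(* Requiring [Some x] keeps the basic neighbourhood away from infinity. *)
have [x Fx] := filter_nonempty (proj1 tF).
exists (Some @` X `|` [set Some x]), (Some @` Y); split.
- by rewrite finite_setU; split; [exact: finite_image|exact: finite_set1].
- exact: finite_image.
- by move=> _ [y /Yi ? <-]; exact/idem_Some.
- split; first exact: tight_star.
    by move=> _ [[y /XF ? <-]|->].
  by move=> _ [y /YF ? <-].
move=> eta [teta Xe Ye]; exists (Some @^-1` eta); last first.
  by rewrite star_pre //; exact: filterS_None (proj1 teta).
apply: sub; split.
- by apply: (tight_pre teta (x := x)); apply: Xe; right.
- by move=> y Xy; apply: Xe; left; exists y.
- by move=> y Yy; apply: Ye; exists y.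
Qed.

Lemma openT_prestar U : openT mulS U -> openT mul [set F | is_tight mul F /\ U (star F)].
Proof.
move=> [Ut oU]; split=> [F []//|F [tF /oU[X [Y [fX fY Yi [_ XF YF] sub]]]]].
exists (Some @^-1` X), (Some @^-1` Y); split.
- exact: finite_preSome.
- exact: finite_preSome.
- by move=> y /Yi/idem_Some.
- by split => // [y /XF|y /YF].
move=> F' [tF' XF' YF']; split => //; apply: sub; split; first exact: tight_star.
  by move=> [x|] //; exact: XF'.
by move=> [y|] // Yy; [exact: YF'|case: (YF _ Yy)].
Qed.

Lemma compactT_star A : A `<=` Tight mul -> compactT mul A -> compactT mulS (star @` A).
Proof.
move=> At cA I U oU AU.
have [i|F AF|J [fJ AJ]] := cA I (fun i => [set F | is_tight mul F /\ U i (star F)]).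
- exact: openT_prestar.
- have [|i _ UF] := AU (star F); first by exists F.
  by exists i => //; split => //; exact: At.
exists J; split => // _ [F AF <-]; have [i Ji [_ UF]] := AJ _ AF.
by exists i.
Qed.

(** An open cover of the preimage pushes forward to open sets that cover all of [B], precisely
    because [B] misses infinity. *)
Lemma compactT_prestar B : B `<=` Tight mulS -> ~ B (star set0) -> compactT mulS B ->
  compactT mul [set F | B (star F)].
Proof.
move=> Bt B0 cB I U oU BU.
have [i|eta Beta|J [fJ BJ]] := cB I (fun i => star @` U i).
- exact: openT_star.
- case: (tightSP (Bt _ Beta)) => [E|F tF E]; first by rewrite E in Beta.
  by have [|i _ UF] := BU F; [rewrite /= -E|exists i => //; exists F].
exists J; split => // F BF; have [i Ji [F' UF' /star_inj E]] := BJ _ BF.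
by exists i; rewrite -?E.
Qed.

(** * Extension and restriction of coefficient functions *)

(** Extension by zero off the image of [star]. At infinity the value is [f set0], which is 0 for [f]
    in [Lc] since the empty set is not a filter. *)
Definition starfun (f : set T -> R) : set (option T) -> R :=
  fun eta => if asbool (eta None) then f (Some @^-1` eta) else 0.

Lemma starfunE f F : starfun f (star F) = f F.
Proof. by rewrite /starfun asboolT. Qed.

Lemma Lc_starfun g f : Lc g f -> LcS g (starfun f).
Proof.
move=> Lf; have ft := Lc_neq0_tight Lf.
have f0 : f set0 = 0.
  by apply: (Lc_zero Lf) => -[/filter_nonempty[]].
pose K : set (set (option T)) := star @` [set F | f F <> 0].
have cK : compactT mulS K by apply: compactT_star; [exact: ft|exact: Lc_compact Lf].
have Kt : K `<=` Tight mulS by move=> _ [F /ft tF <-]; exact: tight_star.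
have fK eta : starfun f eta <> 0 -> K eta.
  rewrite /starfun; case: asboolP => // etaN h.
  by exists (Some @^-1` eta) => //; exact: star_pre.
apply: (Lc_intro (K := K)) => //.
  move=> eta nD; apply: contrapT => /fK[F fF E]; apply: nD; rewrite -E.
  by apply: Dgr_star; apply: contrapT => nD; case: Lf => /(_ _ nD).
(* At infinity a neighbourhood on which the function vanishes is the complement of [K], which is
   compact and hence closed. *)
move=> eta teta; case: (tightSP teta) => [E|F tF E].
  have nK : ~ K eta by rewrite E => -[F + /star_inj F0]; rewrite F0.
  have [_ /(_ eta)[//|X [Y [fX fY Yi XY sub]]]] := compactT_closed cK Kt.
  exists X, Y; split => // xi' /sub[_ nK'].
  transitivity (0 : R); last by symmetry; apply: contrapT => /fK.
  by apply: contrapT => /fK.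
have [X [Y [fX fY Yi [_ XF YF] h]]] := Lc_locally_constant Lf tF.
have [x Fx] := filter_nonempty (proj1 tF).
have [|_ /(_ eta)[|X' [Y' [? ? ? ? sub]]]] :=
  @openT_star (basicT mul X Y); first exact: basicT_open.
  by exists F.
exists X', Y'; split => // xi' /sub[F' /h + <-].
by rewrite E !starfunE.
Qed.

(** Vanishing at infinity keeps the compact support of [b] off that point, so [compactT_prestar]
    applies to it. *)
Lemma Lc_prestar g (b : set (option T) -> R) : LcS g b -> b (star set0) = 0 ->
  Lc g (fun F => b (star F)).
Proof.
move=> Lb b0; have bt := Lc_neq0_tight Lb.
have bD F : b (star F) <> 0 -> Dgr g F.
  move=> h; have DF : DgrS g (star F) by apply: contrapT => nD; case: Lb => /(_ _ nD).
  case: (tightSP (bt _ h)) => [E|F' tF' /star_inj E]; first by rewrite E in h.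
  by apply: DgrS_star => //; rewrite E.
apply: (Lc_intro (K := [set F | b (star F) <> 0])) => //.
- by move=> F nD; apply: contrapT => /bD.
- move=> F tF.
  have [X [Y [fX fY Yi XY h]]] := Lc_locally_constant Lb (tight_star tF).
  have [|_ /(_ F)[//|X' [Y' [? ? ? ? sub]]]] := @openT_prestar (basicT mulS X Y).
    exact: basicT_open.
  by exists X', Y'; split => // F' /sub[_ /h].
- apply: (@compactT_prestar [set eta | b eta <> 0]) => //.
  exact: Lc_compact Lb.
by move=> F /bD[].
Qed.

(** * The embedding of algebras and its image *)

Local Notation mulL := (mulL mul st z phi).
Local Notation mulLS := (Defs.mulL mulS stS zS phiS).

Definition starL (a : G -> set T -> R) : G -> set (option T) -> R :=
  fun g => starfun (a g).

Lemma starL_inj : injective starL.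
Proof.
move=> a b E; apply/funext => g; apply/funext => F.
by rewrite -[a g F]starfunE -[b g F]starfunE -/(starL a g _) E.
Qed.

Lemma supp_starL a : supp (starL a) = supp a.
Proof.
apply/seteqP; split => g h E; apply: h; apply/funext => F.
  by rewrite /starL /starfun E; case: ifP.
by rewrite -[LHS]starfunE -/(starL a g _) E.
Qed.

Lemma inL_starL a : inL a -> inLS (starL a).
Proof.
move=> [fa La]; split; last by move=> g; exact: Lc_starfun.
by have := supp_starL a; rewrite /supp => ->.
Qed.

Lemma starL_mulL a b : inL a -> starL (mulL a b) = mulLS (starL a) (starL b).
Proof.
move=> La; have LSa := inL_starL La.
apply/funext => g; apply/funext => eta.
rewrite (mulLE HS' HG' _ _ _ LSa) supp_starL /starL /starfun.
case: asboolP => etaN; last by rewrite fsbig1 // => s _; rewrite mul0r.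
rewrite (mulLE HS HG _ _ _ La); apply: eq_fsbigr => s _.
have [Ds|nD] := pselect (Dgr s (Some @^-1` eta)); last first.
  by case: La => _ /(_ s)[-> //]; rewrite !mul0r.
by rewrite -[in RHS](star_pre etaN) theta_star // asboolT.
Qed.

Lemma starL_deltaV x g : starL (deltaV mul R x g) = deltaV mulS R (Some x) g.
Proof.
apply/funext => h; apply/funext => eta; rewrite /starL /starfun /deltaV.
case: eqP => _; last by case: ifP.
have [[teta etax]|nV] := pselect (V mulS (Some x) eta).
  rewrite asboolT; last exact: filterS_None (proj1 teta).
  rewrite asboolT; last by split => //; exact: tight_pre teta etax.
  by rewrite asboolT.
rewrite [in RHS](asboolF nV); case: asboolP => // etaN; rewrite asboolF //.
by move=> [tF Fx]; apply: nV; rewrite -(star_pre etaN); split => //; exact: tight_star.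
Qed.

(** Reduces membership in the image to the values at a single point. *)
Lemma starL_surj b : inLS b -> (forall g, b g (star set0) = 0) ->
  exists a, inL a /\ starL a = b.
Proof.
move=> [fb Lb] b0; exists (fun g F => b g (star F)); split.
  split; last by move=> g; exact: Lc_prestar.
  apply: sub_finite_set fb => g h E; apply: h; apply/funext => F.
  by rewrite E.
apply/funext => g; apply/funext => eta; rewrite /starL /starfun.
case: asboolP => etaN; first by rewrite star_pre.
by symmetry; apply: (Lc_zero (Lb g)) => -[/filterS_None/etaN].
Qed.

Lemma starL_infty a g : inL a -> starL a g (star set0) = 0.
Proof.
move=> [_ La]; rewrite /starL starfunE.
by apply: (Lc_zero (La g)) => -[/filter_nonempty[]].
Qed.

Lemma inLS_infty (b : G -> set (option T) -> R) g :
  inLS b -> g <> monoid.one -> b g (star set0) = 0.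
Proof. by move=> [_ Lb] g1; case: (Lb g) => -> // /DgrS_infty. Qed.

Lemma filter_infty : is_filter mulS (star set0).
Proof.
apply: (is_filterI HS').
- by move=> [].
- by exists None.
- by [].
- by move=> [x|] [y|].
- by move=> [x|] [y|].
Qed.

Lemma starL_ideall (y : G -> set (option T) -> R) a : inLS y -> inL a ->
  exists a1, inL a1 /\ starL a1 = mulLS y (starL a).
Proof.
move=> Ly La; apply: starL_surj => [|g].
  by apply: (inL_mulL HS' HG') => //; exact: inL_starL.
rewrite (mulLE HS' HG') //; apply: fsbig1 => s _.
(* At infinity only the degree 1 part of [y] survives, and it is paired with the value of [starL a]
   at infinity again. *)
have [->|s1] := pselect (s = monoid.one); last by rewrite (inLS_infty Ly s1) mul0r.
by rewrite invg1 (theta1 HS' HG' filter_infty) starL_infty // mulr0.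
Qed.

Lemma starL_idealr (y : G -> set (option T) -> R) a : inLS y -> inL a ->
  exists a2, inL a2 /\ starL a2 = mulLS (starL a) y.
Proof.
move=> Ly La; have LSa := inL_starL La; apply: starL_surj => [|g].
  exact: (inL_mulL HS' HG').
rewrite (mulLE HS' HG') //; apply: fsbig1 => s _.
by rewrite starL_infty // mul0r.
Qed.

Lemma idem_None : idem mulS None. Proof. by []. Qed.

Lemma opt_unitalL : unitalL mulS stS zS phiS R.
Proof.
exists (deltaV mulS R None monoid.one); split.
  exact: (inL_deltaV R HS' HG' idem_None).
move=> a La; split; last first.
  apply: (deltaV_mulr HS' HG' idem_None) => // xi [Fxi _].
  exact: filterS_None.
apply/funext => g; apply/funext => eta.
rewrite (deltaV_mull HS' HG' _ _ idem_None) //.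
have [teta|nt] := pselect (is_tight mulS eta).
  by rewrite asboolT ?mul1r //; split => //; exact: filterS_None (proj1 teta).
by case: La => _ /(_ g) La; rewrite (Lc_zero La nt) mulr0.
Qed.

(** * Essentiality and the unital case *)

(** Tightness puts an ultrafilter into the neighbourhood of infinity on which [f] is constant, and
    every ultrafilter is some [star v]. *)
Lemma locally_constant_infty (f : set (option T) -> R) : locally_constant mulS f ->
  is_tight mulS (star set0) -> exists2 F, is_tight mul F & f (star F) = f (star set0).
Proof.
move=> lf tinf; have [X [Y [fX fY Yi [_ XF YF] h]]] := lf _ tinf.
have [u [Uu Xu Yu]] := (proj2 tinf) X Y fX fY Yi XF YF.
have [v Uv E] := ultraS_pre Uu.
exists v; first exact: ultrafilter_tight.
by apply: h; rewrite -E; split => //; exact: ultrafilter_tight.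
Qed.

(** Left multiplication by [deltaV x 1] restricts [y] to [V (Some x)], and these sets cover every
    tight filter except infinity, where local constancy takes over. *)
Lemma starL_essential y : inLS y ->
  (forall a, inL a -> mulLS (starL a) y = @zeroL (option T) G R) ->
  y = @zeroL (option T) G R.
Proof.
move=> Ly y0; have yF g F : is_tight mul F -> y g (star F) = 0.
  move=> tF; have [x Fx] := filter_nonempty (proj1 tF).
  have xx := filter_idem (proj1 tF) Fx.
  have := y0 _ (inL_deltaV R HS HG xx); rewrite starL_deltaV => E.
  have := deltaV_mull HS' HG' g (star F) ((idem_Some x).2 xx) Ly.
  rewrite E asboolT ?mul1r; first by move=> <-.
  by split => //; exact: tight_star.
have [_ Ly'] := Ly.
apply/funext => g; apply/funext => eta; rewrite /zeroL.
have [teta|nt] := pselect (is_tight mulS eta); last exact: (Lc_zero (Ly' g) nt).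
case: (tightSP teta) => [E|F tF ->]; last exact: yF.
rewrite E in teta *.
have [F tF <-] := locally_constant_infty (Lc_locally_constant (Ly' g)) teta.
exact: yF.
Qed.

Lemma starL_surj_unital : (forall b, inLS b -> exists a, inL a /\ starL a = b) ->
  unitalL mul st z phi R.
Proof.
move=> sur; have [e' [Le' ue']] := opt_unitalL.
have [e [Le eE]] := sur _ Le'; exists e; split => // a La.
have [u1 u2] := ue' _ (inL_starL La).
by split; apply: starL_inj; rewrite starL_mulL // eE.
Qed.

(* A unit [e] of [L_R(S)] has [e_1 = 1] on all of [T(E)], although [starL e] vanishes
   at infinity; so infinity is isolated from [T(E)], i.e. not tight. *)
Lemma unital_starL_surj : unitalL mul st z phi R ->
  forall b, inLS b -> exists a, inL a /\ starL a = b.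
Proof.
move=> [e [Le ue]] b Lb; apply: starL_surj => // g.
have e1 F : is_tight mul F -> e monoid.one F = 1.
  move=> tF; have [x Fx] := filter_nonempty (proj1 tF).
  have xx := filter_idem (proj1 tF) Fx.
  have Lx := inL_deltaV R HS HG xx.
  have := deltaV_mull HS HG monoid.one F xx Le.
  by rewrite (proj2 (ue _ Lx)) /deltaV eqxx asboolT // mul1r => <-.
have [tinf|nt] := pselect (is_tight mulS (star set0)); last first.
  by case: Lb => _ /(_ g) Lb; exact: (Lc_zero Lb nt).
have [_ LSe] := inL_starL Le.
have [F tF] := locally_constant_infty (Lc_locally_constant (LSe monoid.one)) tinf.
(* A tight infinity yields [1 = 0] in [R]. As [R] may be the zero ring, this is not a contradiction;
   it makes every value 0. *)
rewrite starL_infty // /starL starfunE e1 // => E.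
by rewrite -[LHS]mul1r E mul0r.
Qed.

End AdjoinIdentity.

Theorem mainTheorem19 (T : Type) (mul : T -> T -> T) (st : T -> T) (z : T)
    (G : groupType) (phi : T -> G) (R : comPzRingType) :
  is_inv_semigroup0 mul st z ->
  (exists s, s <> z) ->
  pure_grading mul z phi ->
  let mulS := optmul mul in let stS := optstar st in let zS := Some z in
  let phiS := optphi phi in
  [/\ is_inv_semigroup0 mulS stS zS,
      pure_grading mulS zS phiS,
      (forall x Z, idem mul x -> is_fincover mul z x Z ->
         is_fincover mulS zS (Some x) (Some @` Z)),
      unitalL mulS stS zS phiS R &
      exists iota : (G -> set T -> R) -> (G -> set (option T) -> R),
        [/\ (forall a, inL mul st z phi a -> inL mulS stS zS phiS (iota a)),
            (forall a b, inL mul st z phi a -> inL mul st z phi b ->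
               iota (addL a b) = addL (iota a) (iota b)),
            (forall (r : R) a, inL mul st z phi a ->
               iota (scaleL r a) = scaleL r (iota a)),
            (forall a b, inL mul st z phi a -> inL mul st z phi b ->
               iota (mulL mul st z phi a b) = mulL mulS stS zS phiS (iota a) (iota b)) &
            (forall a b, inL mul st z phi a -> inL mul st z phi b ->
               iota a = iota b -> a = b)] /\
            (forall g x, Egr mul st z phi g x ->
               iota (deltaV mul R x g) = deltaV mulS R (Some x) g) /\
            ((forall b, inL mulS stS zS phiS b ->
                exists a, inL mul st z phi a /\ iota a = b)
             <-> unitalL mul st z phi R) /\
            (forall y a, inL mulS stS zS phiS y -> inL mul st z phi a ->
               (exists a1, inL mul st z phi a1 /\
                  iota a1 = mulL mulS stS zS phiS y (iota a)) /\
               (exists a2, inL mul st z phi a2 /\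
                  iota a2 = mulL mulS stS zS phiS (iota a) y)) /\
            (forall y, inL mulS stS zS phiS y ->
               (forall a, inL mul st z phi a ->
                  mulL mulS stS zS phiS y (iota a) = @zeroL (option T) G R /\
                  mulL mulS stS zS phiS (iota a) y = @zeroL (option T) G R) ->
               y = @zeroL (option T) G R)].
Proof.
move=> HS Hne HG mulS stS zS phiS; split.
- exact: opt_inv_semigroup0.
- exact: opt_pure_grading.
- by move=> x Z _; exact: opt_fincover.
- exact: (opt_unitalL R HS HG).
exists (@starL T G R); split; [split|split; [|split; [|split]]].
- by move=> a; exact: inL_starL.
- move=> a b _ _; apply/funext => g; apply/funext => eta.
  by rewrite /addL /starL /starfun; case: ifP => // _; rewrite addr0.
- move=> r a _; apply/funext => g; apply/funext => eta.
  by rewrite /scaleL /starL /starfun; case: ifP => // _; rewrite mulr0.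
- by move=> a b La _; exact: starL_mulL.
- by move=> a b _ _; exact: starL_inj.
- by move=> g x _; exact: (starL_deltaV _ HS).
- by split; [exact: starL_surj_unital|exact: unital_starL_surj].
- by move=> y a Ly La; split; [exact: starL_ideall|exact: starL_idealr].
by move=> y Ly y0; apply: (starL_essential HS HG) => // a /y0[].
Qed.
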